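(* Let $\mathcal{X}$ be the set of isomorphism classes of mm-spaces, equipped with the box distance $\Box$. If $\mathcal{Y}\subset\mathcal{X}$ is a precompact set in $(\mathcal{X},\Box)$, then there exists an mm-space $X$ such that $Y\prec X$ for every $Y\in\mathcal{Y}$.
   Context: A metric measure space (mm-space) is a triple $X=(X,d_X,\mu_X)$ where $\mu_X$ is a Borel probability measure on a complete separable metric space $(X,d_X)$. Two mm-spaces $X,Y$ are isomorphic if there is an isometry $F:\operatorname{supp}\mu_X\to\operatorname{supp}\mu_Y$ with $F_*\mu_X=\mu_Y$; $\mathcal{X}$ is the set of isomorphism classes. No careful distinction is made between an mm-space and its class in $\mathcal{X}$. Box distance: a parameter of an mm-space $X$ is a Borel map $\varphi:[0,1)\to X$ with $\varphi_*\mathcal{L}^1=\mu_X$, where $\mathcal{L}^1$ is Lebesgue measure on $[0,1)$. $\Box(X,Y)$ is the infimum of $\varepsilon\ge 0$ for which there exist parameters $\varphi$ of $X$ and $\psi$ of $Y$ and a Borel set $I_0\subset[0,1)$ with $\mathcal{L}^1(I_0)\ge 1-\varepsilon$ and $|d_X(\varphi(s),\varphi(t))-d_Y(\psi(s),\psi(t))|\le\varepsilon$ for all $s,t\in I_0$. This is a complete metric on $\mathcal{X}$. Precompact means having compact closure. Lipschitz order: for mm-spaces $X,Y$, $Y\prec X$ ($X$ dominates $Y$) means that there exists a $1$-Lipschitz map $f:X\to Y$ with $f_*\mu_X=\mu_Y$. *)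

(* Defs.v *)
From HB Require Import structures.
From mathcomp Require Import all_boot all_order all_algebra generic_quotient.
From mathcomp Require Import all_classical all_reals all_analysis.

Set Implicit Arguments.
Unset Strict Implicit.
Unset Printing Implicit Defensive.

Import Order.TTheory GRing.Theory Num.Theory.

Local Open Scope classical_set_scope.
Local Open Scope ring_scope.

(* [Complete] includes a distinguished point, which is only needed to form
   measurable types; no definition below depends on it. *)
#[short(type="completeMetricType")]
HB.structure Definition CompleteMetric (R : numDomainType) :=
  {T of Complete T & Metric R T}.

Definition separable_space (T : topologicalType) :=
  exists2 S : set T, countable S & dense S.

Notation borel T := (g_sigma_algebraType (@open T)).

Record mmspace (R : realType) := MMSpace {
  mm_carrier :> completeMetricType R ;
  mm_separable : separable_space mm_carrier ;
  mm_measure : probability (borel mm_carrier) R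
}.

HB.instance Definition _ (R : realType) := gen_eqMixin (mmspace R).
HB.instance Definition _ (R : realType) := gen_choiceMixin (mmspace R).

Section mmspace.
Context {R : realType}.
Implicit Types X Y Z : mmspace R.

Definition mm_supp X : set X :=
  [set x | forall U : set X, open U -> U x -> (0 < mm_measure X U)%E].
Arguments mm_supp X : clear implicits.

(* F matters only on the support of X; the last clause says that it maps the
   restriction of the measure of X to supp X to that of Y to supp Y. *)
Definition mm_isomorphic X Y :=
  exists F : X -> Y,
    [/\ set_bij (mm_supp X) (mm_supp Y) F,
        {in mm_supp X &, forall x x', mdist (F x) (F x') = mdist x x'} &
        forall A : set (borel Y), measurable A ->
          mm_measure X (mm_supp X `&` F @^-1` A) =
          mm_measure Y (mm_supp Y `&` A)].

Definition mm_isomorphicb X Y := `[< mm_isomorphic X Y >].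

(* phi is constrained only on [0, 1[; its values elsewhere are junk. *)
Definition mm_parameter X (phi : R -> X) :=
  measurable_fun (`[0, 1[ : set R) (phi : R -> borel X) /\
  forall A : set (borel X), measurable A ->
    lebesgue_measure ((`[0, 1[ : set R) `&` phi @^-1` A) = mm_measure X A.

Definition box X Y : R := inf
  [set e | 0 <= e /\
    exists (phi : R -> X) (psi : R -> Y) (I0 : set R),
      [/\ mm_parameter phi, mm_parameter psi,
          measurable I0 /\ I0 `<=` `[0, 1[,
          ((1 - e)%:E <= lebesgue_measure I0)%E &
          forall s t, I0 s -> I0 t ->
            `|mdist (phi s) (phi t) - mdist (psi s) (psi t)| <= e]].

Definition dominated Y X :=
  exists f : X -> Y,
    (forall x x', mdist (f x) (f x') <= mdist x x') /\
    forall A : set (borel Y), measurable A ->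
      pushforward (mm_measure X) (f : borel X -> borel Y) A = mm_measure Y A.

Lemma mm_supp_measurable X : @measurable _ (borel X) (mm_supp X).
Proof.
rewrite -[mm_supp X]setCK; apply: (@measurableC _ (borel X)).
apply: sub_sigma_algebra => /=.
rewrite (_ : ~` _ = \bigcup_(U in [set U | open U /\ ~ (0 < mm_measure X U)%E]) U).
  by apply: bigcup_open => U [].
apply/seteqP; split=> [x|x [U [oU U0] Ux] /(_ U oU Ux)//].
by move=> /existsNP[U] /not_implyP[oU] /not_implyP[Ux U0]; exists U.
Qed.

Lemma isometry_measurable X Y (F : X -> Y) :
  {in mm_supp X &, forall x x', mdist (F x) (F x') = mdist x x'} ->
  measurable_fun (mm_supp X : set (borel X)) (F : borel X -> borel Y).
Proof.
move=> Fd; apply: (@measurability _ _ (borel X) (borel Y) _ _ (@open Y)) => //.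
move=> _ [A oA <-].
pose W := \bigcup_(i in [set i : X * R | [/\ mm_supp X i.1, 0 < i.2 &
  ball (F i.1) i.2 `<=` A]]) (ball i.1 i.2)°.
rewrite (_ : _ `&` _ = mm_supp X `&` W).
  apply: (@measurableI _ (borel X)); first exact: mm_supp_measurable.
  by apply: sub_sigma_algebra; apply: bigcup_open => i _; exact: open_interior.
apply/seteqP; split=> x [sx].
  move=> /= AFx; split => //.
  have /nbhs_ballP[e /= e0 eA] : nbhs (F x) A by exact: open_nbhs_nbhs.
  by exists (x, e) => //=; exact: nbhsx_ballx.
move=> [[z e] /= [sz e0 eA]] /interior_subset; rewrite ballEmdist /= => zx.
by split => //; apply: eA; rewrite ballEmdist /= Fd ?inE.
Qed.

Lemma mm_isomorphic_sym_sub X Y : mm_isomorphic X Y -> mm_isomorphic Y X.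
Proof.
move=> [F [[Ff Fi Fs] Fd Fm]].
pose G y := xget point [set x | mm_supp X x /\ F x = y].
have GP y : mm_supp Y y -> mm_supp X (G y) /\ F (G y) = y.
  move=> /Fs[x sx Fx].
  by have := @xgetPex _ point [set x | mm_supp X x /\ F x = y]; apply; exists x.
have GF x : mm_supp X x -> G (F x) = x.
  by move=> sx; have [sG FG] := GP _ (Ff _ sx); apply: Fi; rewrite ?inE.
have Gd : {in mm_supp Y &, forall y y', mdist (G y) (G y') = mdist y y'}.
  move=> y y' /set_mem /GP[sy Fy] /set_mem /GP[sy' Fy'].
  by rewrite -Fd ?inE// Fy Fy'.
exists G; split => //.
  split=> [y /GP[]//| y y' /set_mem /GP[_ Fy] /set_mem /GP[_ Fy'] GG|x sx].
    by rewrite -Fy GG.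
  by exists (F x); [exact: Ff|exact: GF].
move=> B mB.
have mA := isometry_measurable Gd (@mm_supp_measurable Y) mB.
have := Fm _ mA; rewrite (setIA (mm_supp Y)) setIid => <-; congr (mm_measure X _).
apply/seteqP; split=> x [sx] /=; first by move=> [_]; rewrite GF.
by move=> Bx; split=> //; split; [exact: Ff|rewrite GF].
Qed.

Lemma mm_isomorphic_refl : reflexive mm_isomorphicb.
Proof.
move=> X; apply/asboolP; exists id; split=> //; split=> //.
by move=> x sx; exists x.
Qed.

Lemma mm_isomorphic_sym : symmetric mm_isomorphicb.
Proof. by move=> X Y; apply/asboolP/asboolP; exact: mm_isomorphic_sym_sub. Qed.

Lemma mm_isomorphic_trans : transitive mm_isomorphicb.
Proof.
move=> Y X Z /asboolP[F [[Ff Fi Fs] Fd Fm]] /asboolP[G [[Gf Gi Gs] Gd Gm]].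
apply/asboolP; exists (G \o F); split.
- split=> [x /Ff/Gf//|x x' sx sx' GF|z /Gs[y /Fs[x sx <-] <-]]; last by exists x.
  by apply: Fi => //; apply: Gi => //; rewrite inE; apply: Ff; exact: set_mem.
- move=> x x' sx sx' /=; rewrite Gd ?Fd// inE; apply: Ff; exact: set_mem.
- move=> A mA; rewrite -Gm//.
  have mB := isometry_measurable Gd (@mm_supp_measurable Y) mA.
  have := Fm _ mB; rewrite (setIA (mm_supp Y)) setIid => <-; congr (mm_measure X _).
  by apply/seteqP; split=> x [sx] /= => [AG|[_ AG]]; do ?split => //; exact: Ff.
Qed.

Canonical mm_isomorphic_equiv := EquivRel mm_isomorphicb
  mm_isomorphic_refl mm_isomorphic_sym mm_isomorphic_trans.
End mmspace.

Local Open Scope quotient_scope.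

Definition mmclass (R : realType) : Type := {eq_quot (@mm_isomorphic_equiv R)}.
HB.instance Definition _ (R : realType) := Choice.on (mmclass R).
HB.instance Definition _ (R : realType) := EqQuotient.on (mmclass R).

Section mmclass.
Context {R : realType}.

(* The value does not depend on the representatives. *)
Definition class_box (C D : mmclass R) : R := box (repr C) (repr D).

(* The metric topology: isOpenTopological, unlike the metric factories, does not
   require the metric axioms of the box distance. *)
Definition box_open (U : set (mmclass R)) :=
  forall C, U C -> exists2 e : R, 0 < e & [set D | class_box C D < e] `<=` U.

Lemma box_openT : box_open setT.
Proof. by move=> C _; exists 1. Qed.

Lemma box_openI : setI_closed box_open.
Proof.
move=> U V oU oV C [/oU[e e0 eU] /oV[d d0 dV]].
exists (Order.min e d); first by rewrite lt_min e0 d0.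
by move=> D /=; rewrite lt_min => /andP[/eU ? /dV].
Qed.

Lemma box_open_bigU (I : Type) (f : I -> set (mmclass R)) :
  (forall i, box_open (f i)) -> box_open (\bigcup_i f i).
Proof.
move=> of_ C [i _ /(of_ i)[e e0 ef]]; exists e => // D /ef fD; by exists i.
Qed.

HB.instance Definition _ := isOpenTopological.Build (mmclass R)
  box_openT box_openI box_open_bigU.
End mmclass.

(* Main.v *)
Require Import Defs.
From HB Require Import structures.
From mathcomp Require Import all_boot all_order all_algebra generic_quotient.
From mathcomp Require Import all_classical all_reals all_analysis.
From mathcomp Require Import measurable_realfun lra.

(* Precompactness gives, at every scale e_j = 2^-(j+2), a number N_j such that
   every Y of the family is, up to measure e_j, a union of N_j pieces of diameter
   at most e_j and mutual distance at most N_j.  The set K_m of the points lying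
   in such a union at every scale j >= m has measure at least 1 - 2^-(m+1).

   The dominating space is the space of sequences of naturals with a product of
   geometric distributions.  Writing the measure of Y as a mixture of
   probabilities carried by the K_m with the universal weights 2^-(m+1), then each
   component as a mixture, with universal geometric weights, of probabilities
   carried by single pieces of the next scale, and so on, every sequence
   determines a point of Y, and the resulting map sends the product measure to
   the measure of Y.  Since some of N pieces always has mass at least 1/N, a
   geometric distribution of ratio at least 1 - 1/N is fine enough for any
   masses of the pieces.  Two sequences with entry 0 at most m which first differ
   at index k >= m + 2 are sent to points at distance at most e_(k-2) from all
   points of a common piece of scale k - 2, and any two are sent to points at
   distance at most N_0 + ... + N_m + 1; these bounds are independent of Y, and
   define an ultrametric on sequences for which all the maps are 1-Lipschitz.

   Applied to a single Y this produces a parameter of Y, so that the infimum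
   defining the box distance is over a nonempty set.  Being covered, up to
   measure < e, by n pieces of diameter < e is open for the box distance, and
   compactness bounds n. *)

Import Order.TTheory GRing.Theory Num.Theory.
Import numFieldNormedType.Exports.
Local Open Scope classical_set_scope.
Local Open Scope ring_scope.
Local Open Scope quotient_scope.
Set Implicit Arguments.
Unset Strict Implicit.
Unset Printing Implicit Defensive.

(** * The ultrametric space of sequences *)

Record scale (R : realType) := Scale {
  scale_fun :> nat -> nat -> R ;
  scale_gt0 : forall m k, 0 < scale_fun m k ;
  scale_homo : forall m m' k k', (m <= m')%N -> (k' <= k)%N ->
    scale_fun m k <= scale_fun m' k' ;
  scale_small : forall m e, 0 < e -> exists k, scale_fun m k < e }.

(* Sequences of naturals; the first entry is the piece of the space the point
   lies in, and a scale bounds the distance of two points in terms of their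
   pieces and of the first index at which they differ. *)
Definition baire (R : realType) (s : scale R) := nat -> nat.

Section baire.
Context {R : realType} (s : scale R).
Implicit Types x y z : baire s.

HB.instance Definition _ := gen_eqMixin (baire s).
HB.instance Definition _ := gen_choiceMixin (baire s).
HB.instance Definition _ := isPointed.Build (baire s) (fun=> 0%N).

(** The scale does not increase with the index, so the supremum is its value at the first
    difference; for [x = y] it is the supremum of the empty set, 0. *)
Definition bdist x y : R :=
  sup [set s (maxn (x 0%N) (y 0%N)) k | k in [set k | x k <> y k]].

Lemma bdist_ge x y k : x k <> y k -> s (maxn (x 0%N) (y 0%N)) k <= bdist x y.
Proof.
move=> xy; apply: ub_le_sup; last by exists k.
by exists (s (maxn (x 0%N) (y 0%N)) 0%N) => _ [j _ <-]; exact: scale_homo.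
Qed.

Lemma bdist_le x y c : 0 <= c ->
  (forall k, x k <> y k -> s (maxn (x 0%N) (y 0%N)) k <= c) -> bdist x y <= c.
Proof.
move=> c0 xyc; rewrite /bdist; set A := (X in sup X).
have [->|/set0P A0] := eqVneq A set0; first by rewrite sup0.
by apply: ge_sup => // _ [k xyk <-]; exact: xyc.
Qed.

Lemma bdist_ge0 x y : 0 <= bdist x y.
Proof.
have [[k xyk]|xy] := pselect (exists k, x k <> y k).
  exact: le_trans (ltW (scale_gt0 _ _ _)) (bdist_ge xyk).
rewrite /bdist (_ : [set k | _] = set0) ?image_set0 ?sup0//.
by apply/seteqP; split=> // k xyk; apply: xy; exists k.
Qed.

Lemma bdistxx x : bdist x x = 0.
Proof. by apply/eqP; rewrite eq_le bdist_ge0 andbT; apply: bdist_le. Qed.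

Lemma bdist_positivity x y : bdist x y = 0 -> x = y.
Proof.
move=> xy; apply/funext => k; apply: contrapT => xyk.
by have := scale_gt0 s (maxn (x 0%N) (y 0%N)) k; rewrite ltNge -xy bdist_ge.
Qed.

Lemma bdist_sym x y : bdist x y = bdist y x.
Proof.
rewrite /bdist maxnC; congr (sup (image _ _)).
by apply/seteqP; split=> k /= /nesym.
Qed.

(** If [z 0] exceeds both other first entries, then [y] and [z] already differ at index 0, where the
    scale is largest; otherwise the difference of [x] and [y] at [k] suffices. *)
Let bdist_triangle_aux x y z k : x k <> y k ->
  s (maxn (x 0%N) (z 0%N)) k <= bdist x y + bdist y z.
Proof.
move=> xyk; have [zxy|xyz] := leqP (z 0%N) (maxn (x 0%N) (y 0%N)).
  rewrite -[leLHS]addr0 lerD ?bdist_ge0// (le_trans _ (bdist_ge xyk))//.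
  by apply: scale_homo => //; rewrite geq_max zxy leq_maxl.
rewrite -[leLHS]add0r lerD ?bdist_ge0//.
move: xyz; rewrite gtn_max => /andP[xz yz].
have yz0 : y 0%N <> z 0%N by move=> yz0; rewrite yz0 ltnn in yz.
rewrite (le_trans _ (bdist_ge yz0))//; apply: scale_homo => //.
by rewrite geq_max (leq_trans (ltnW xz)) leq_maxr.
Qed.

Lemma bdist_triangle y x z : bdist x z <= bdist x y + bdist y z.
Proof.
apply: bdist_le => [|k xz]; first by rewrite addr_ge0// bdist_ge0.
have [xy|/eqP xy] := eqVneq (x k) (y k); last exact: bdist_triangle_aux.
rewrite maxnC addrC (bdist_sym x) (bdist_sym y).
by apply: bdist_triangle_aux; rewrite -xy => /esym.
Qed.

HB.instance Definition _ := isMetric.Build R (baire s)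
  bdistxx bdist_positivity bdist_sym bdist_triangle.

Lemma mdist_baire x y : mdist x y = bdist x y.
Proof. by []. Qed.

Lemma bdist_lt_eq x y m k : x 0%N = m -> bdist x y < s m k -> x k = y k.
Proof.
move=> xm; apply: contraPP => xy; apply/negP; rewrite -leNgt.
by rewrite (le_trans _ (bdist_ge xy))// scale_homo// -xm leq_maxl.
Qed.

Lemma bdist_agree x y k : (forall i, (i <= k)%N -> x i = y i) ->
  bdist x y <= s (x 0%N) k.
Proof.
move=> xy; apply: bdist_le => [|j xyj]; first exact/ltW/scale_gt0.
rewrite -xy// maxnn scale_homo// leqNgt; apply/negP => jk.
by apply: xyj; apply: xy; exact: ltnW.
Qed.

Lemma baire_complete (F : set_system (baire s)) :
  ProperFilter F -> cauchy F -> cvg F.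
Proof.
move=> FF /cauchyP Fc.
have FE k : exists a : nat, F [set y | y k = a].
  suff [m Fm] : exists m, F [set y | y 0%N = m].
    have [z Fz] := Fc _ (scale_gt0 s m k); exists (z k).
    apply: filterS (filterI Fm Fz) => y []/= ym.
    rewrite ballEmdist/= mdist_baire bdist_sym => zy.
    exact: bdist_lt_eq zy.
  (* Since [s 0 0] is at most every [s m 0], this radius forces equal first entries before any bound
     on them is known. *)
  have [z Fz] := Fc _ (scale_gt0 s 0%N 0%N); exists (z 0%N).
  apply: filterS Fz => y; rewrite ballEmdist/= mdist_baire bdist_sym => zy.
  apply: (@bdist_lt_eq _ _ (y 0%N)) => //.
  by rewrite (lt_le_trans zy)// scale_homo.
have /choice[a Fa] := FE.
have Fa' k : F [set y | forall i, (i <= k)%N -> y i = a i].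
  elim: k => [|k IH].
    by apply: filterS (Fa 0%N) => y /= ya i; rewrite leqn0 => /eqP ->.
  apply: filterS (filterI IH (Fa k.+1)) => y []/= ya yk i.
  by rewrite leq_eqVlt => /predU1P[->//|]; rewrite ltnS; exact: ya.
apply/cvg_ex; exists (a : baire s).
apply/metricType_numDomainType.fcvgrPdist_lt => e e0.
have [k sk] := scale_small s (a 0%N) e0.
apply: filterS (Fa' k) => y ya; rewrite mdist_baire (le_lt_trans _ sk)//.
by apply: bdist_agree => i ik; rewrite ya.
Qed.

HB.instance Definition _ := Uniform_isComplete.Build (baire s) baire_complete.

Definition cylinder (l : seq nat) : set (baire s) :=
  [set x | forall i, (i < size l)%N -> x i = nth 0%N l i].

(** There are countably many cylinders: this yields both separability and the measurability of the
    digit map. *)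
Lemma open_baireE (U : set (baire s)) : open U ->
  U = \bigcup_(l in [set l | cylinder l `<=` U]) cylinder l.
Proof.
move=> oU; apply/seteqP; split=> [x Ux|x [l /=]]; last exact.
have /nbhs_ballP[e /= e0 eU] : nbhs x U by exact: open_nbhs_nbhs.
have [k sk] := scale_small s (x 0%N) e0.
exists (mkseq x k.+1) => /=; last first.
  by move=> i; rewrite size_mkseq => ik; rewrite nth_mkseq.
move=> y yl; apply: eU; rewrite ballEmdist/= (le_lt_trans _ sk)//.
apply: bdist_agree => i ik; rewrite yl ?size_mkseq ?ltnS//.
by rewrite nth_mkseq.
Qed.

Lemma separable_baire : separable_space (baire s).
Proof.
exists (range (fun l : seq nat => nth 0%N l : baire s)).
  exact: card_le_trans (card_image_le _ _) (countableP _).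
move=> U [x Ux] oU; move: Ux; rewrite (open_baireE oU) => -[l lU _].
exists (nth 0%N l); split; first by exists l.
by exists l.
Qed.

End baire.

(** * Geometric digits of a real number *)

Section digits.
Context {R : realType}.
Implicit Types (r v a w : R) (n k d : nat).

(* [dig r v] is the n such that v lies in the n-th block [1 - r^n, 1 - r^(n+1)[
   of [0, 1[ (junk value 0 outside of [0, 1[), and [dstep r v] is the relative
   position of v in this block. *)
Definition dig r v : nat :=
  xget 0%N [set n | 1 - r ^+ n <= v < 1 - r ^+ n.+1].

Definition dstep r v : R :=
  (v - (1 - r ^+ dig r v)) / ((1 - r) * r ^+ dig r v).

Lemma block_inj r v m n : 0 < r < 1 ->
  1 - r ^+ m <= v < 1 - r ^+ m.+1 -> 1 - r ^+ n <= v < 1 - r ^+ n.+1 -> m = n.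
Proof.
move=> /andP[r0 r1].
have aux i j : (i < j)%N -> 1 - r ^+ i <= v < 1 - r ^+ i.+1 ->
    1 - r ^+ j <= v < 1 - r ^+ j.+1 -> False.
  move=> ij /andP[_ vi] /andP[jv _].
  have ji : 1 - r ^+ i.+1 <= 1 - r ^+ j.
    by rewrite lerD2l lerN2 ler_wiXn2l// ltW.
  by have := lt_le_trans vi (le_trans ji jv); rewrite ltxx.
by case: (ltngtP m n) => // mn mv nv; exfalso; [exact: aux mv nv|exact: aux nv mv].
Qed.

Lemma dig_eq r v n : 0 < r < 1 -> 1 - r ^+ n <= v < 1 - r ^+ n.+1 ->
  dig r v = n.
Proof.
move=> r01 vn; rewrite /dig; case: xgetP => [m _ /= mv|/(_ n)//].
exact: block_inj mv vn.
Qed.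

Lemma block_exists r v : 0 < r < 1 -> 0 <= v < 1 ->
  exists n, 1 - r ^+ n <= v < 1 - r ^+ n.+1.
Proof.
move=> /andP[r0 r1] /andP[v0 v1].
have ex : exists n, v < 1 - r ^+ n.
  have /cvgrPdist_lt/(_ (1 - v)) : (r ^+ n) @[n --> \oo] --> (0 : R).
    by apply: cvg_expr; rewrite gtr0_norm.
  rewrite subr_gt0 => /(_ v1) [n _ /(_ n (leqnn n))] /=.
  rewrite sub0r normrN gtr0_norm ?exprn_gt0// => rv; exists n; lra.
case: (ex_minnP ex) => -[|n] vn nmin; first by move: vn; rewrite expr0; lra.
exists n; rewrite vn andbT leNgt; apply/negP => /nmin.
by rewrite ltnn.
Qed.

Lemma measurable_dig r n : 0 < r < 1 -> measurable [set v | dig r v = n].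
Proof.
move=> r01; pose B m := `[1 - r ^+ m, 1 - r ^+ m.+1[%classic : set R.
have BE v m : B m v = (1 - r ^+ m <= v < 1 - r ^+ m.+1) :> Prop.
  by rewrite /B /= in_itv.
(* The second set accounts for the junk digit 0 outside all blocks. *)
rewrite (_ : [set v | _] = B n `|` (~` (\bigcup_m B m) `&` [set _ | n = 0%N])).
  apply: measurableU; first exact: measurable_itv.
  apply: measurableI; last first.
    have [n0|n0] := pselect (n = 0%N).
      by rewrite (_ : [set _ | _] = setT)//; apply/seteqP; split.
    by rewrite (_ : [set _ | _] = set0)//; apply/seteqP; split.
  by apply: measurableC; apply: bigcup_measurable => m _; exact: measurable_itv.
apply/seteqP; split=> v /=.
  move=> vn; have [[m _ vm]|vD] := pselect ((\bigcup_m B m) v).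
    by left; rewrite -vn; move: (vm); rewrite BE => /(dig_eq r01) ->.
  right; split=> //; rewrite -vn /dig; case: xgetP => // m _ /= vm.
  by exfalso; apply: vD; exists m; rewrite ?BE.
move=> [|[vD ->]]; first by rewrite BE => /(dig_eq r01).
rewrite /dig; case: xgetP => // m _ /= vm.
by exfalso; apply: vD; exists m; rewrite ?BE.
Qed.

Lemma measurable_dig_dep (disp : measure_display) (T : measurableType disp) r
    (H : nat -> R -> T) :
  0 < r < 1 -> (forall n, measurable_fun setT (H n)) ->
  measurable_fun setT (fun v => H (dig r v) v).
Proof.
move=> r01 mH _ B mB; rewrite setTI.
rewrite (_ : _ @^-1` _ = \bigcup_n ([set v | dig r v = n] `&` (H n @^-1` B))).
  apply: bigcup_measurable => n _; apply: measurableI.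
    exact: measurable_dig.
  by rewrite -[X in measurable X]setTI; exact: mH.
by apply/seteqP; split=> [v Hv|v [n _ [/= <-]]//]; exists (dig r v).
Qed.

Lemma measurable_dstep r : 0 < r < 1 -> measurable_fun setT (dstep r).
Proof.
move=> r01.
apply: (measurable_dig_dep
  (H := fun n v => (v - (1 - r ^+ n)) / ((1 - r) * r ^+ n))) => // n.
apply: measurable_funM; last exact: measurable_cst.
by apply: measurable_funB => //; exact: measurable_cst.
Qed.

Variable r : nat -> R.
Hypothesis r01 : forall d, 0 < r d < 1.

(** For uniform [v] the digits are independent and geometric, the k-th of ratio [r (d + k)]: the
    relative position in a block is again uniform. *)
Fixpoint digits d v k : nat :=
  if k is k.+1 then digits d.+1 (dstep (r d) v) k else dig (r d) v.

Lemma measurable_digits_prefix (l : seq nat) d :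
  measurable [set v | forall i, (i < size l)%N -> digits d v i = nth 0%N l i].
Proof.
elim: l d => [|n l IH] d.
  by rewrite (_ : [set v | _] = setT)//; apply/seteqP; split.
rewrite (_ : [set v | _] = [set v | dig (r d) v = n] `&` (dstep (r d) @^-1`
    [set v | forall i, (i < size l)%N -> digits d.+1 v i = nth 0%N l i])).
  apply: measurableI; first exact: measurable_dig.
  by rewrite -[X in measurable X]setTI; exact: measurable_dstep.
apply/seteqP; split=> [v vl|v [/= vn vl] [|i]//]; last exact: vl.
by split=> [|i il]; [exact: (vl 0%N)|exact: (vl i.+1)].
Qed.

Variables (S : Type) (child : nat -> S -> nat -> S).

Fixpoint walk d (t : S) (x : nat -> nat) k : S :=
  if k is k.+1 then walk d.+1 (child d t (x 0%N)) (fun i => x i.+1) k else t.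

Lemma walkS d t x k : walk d t x k.+1 = child (d + k) (walk d t x k) (x k).
Proof.
elim: k d t x => [|k IH] d t x; first by rewrite addn0.
by rewrite -[LHS]/(walk d.+1 (child d t (x 0%N)) (fun i => x i.+1) k.+1) IH addSnnS.
Qed.

Lemma eq_walk d t x y k : (forall i, (i < k)%N -> x i = y i) ->
  walk d t x k = walk d t y k.
Proof.
elim: k d t x y => [//|k IH] d t x y xy /=; rewrite xy//.
by apply: IH => i ik; exact: xy.
Qed.

Lemma measurable_walk (g : S -> \bar R) d t k :
  measurable_fun setT (fun v => g (walk d t (digits d v) k)).
Proof.
elim: k d t => [|k IH] d t /=; first exact: measurable_cst.
apply: (measurable_dig_dep (H := fun n v =>
  g (walk d.+1 (child d t n) (digits d.+1 (dstep (r d) v)) k))) => // n.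
apply: (measurableT_comp (IH _ _)); exact: measurable_dstep.
Qed.

(** A martingale property: [g] at a node is the weighted mean of [g] at its children. Allowing any
    interval lets the induction hypothesis apply to each block without a change of variables. *)
Lemma integral_walk (g : S -> \bar R) :
  (forall t, 0 <= g t)%E ->
  (forall d t, g t = \sum_(n <oo) ((1 - r d) * r d ^+ n)%R%:E * g (child d t n))%E ->
  forall k d t a w, 0 < w ->
  (\int[lebesgue_measure]_(u in `[a, (a + w)%R[)
     g (walk d t (digits d ((u - a) / w)%R) k) = w%:E * g t)%E.
Proof.
move=> g0 gE; elim=> [|k IH] d t a w w0 /=.
  rewrite integral_cst//= ?measurable_itv// lebesgue_measure_itv/= lte_fin ltrDl w0.
  by rewrite -EFinD addrAC subrr add0r muleC.
have /andP[rd0 rd1] := r01 d.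
pose b n := a + w * (1 - r d ^+ n).
pose F n := `[b n, b n + w * ((1 - r d) * r d ^+ n)[%classic : set R.
have bE n : b n + w * ((1 - r d) * r d ^+ n) = b n.+1.
  rewrite /b -addrA -mulrDr; congr (_ + _ * _).
  by rewrite mulrBl mul1r exprS addrA subrK.
have FE n u : F n u <-> 1 - r d ^+ n <= (u - a) / w < 1 - r d ^+ n.+1.
  rewrite /F bE /b /= in_itv/= ler_pdivlMr// ltr_pdivrMr//.
  by rewrite lerBrDl ltrBlDl ![_ * w]mulrC.
have w'0 n : 0 < w * ((1 - r d) * r d ^+ n).
  by rewrite mulr_gt0// mulr_gt0 ?exprn_gt0// subr_gt0.
have UF : `[a, a + w[%classic = \bigcup_n F n.
  apply/seteqP; split=> u.
    rewrite /= in_itv/= => /andP[au uw].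
    have [n un] : exists n, 1 - r d ^+ n <= (u - a) / w < 1 - r d ^+ n.+1.
      apply: block_exists => //; rewrite divr_ge0 ?subr_ge0 ?(ltW w0)//=.
      by rewrite ltr_pdivrMr// mul1r ltrBlDl.
    by exists n => //; apply/FE.
  move=> [n _ /FE/andP[]]; rewrite ler_pdivlMr// ltr_pdivrMr// => nu un.
  rewrite /= in_itv/= -subr_ge0 (le_trans _ nu)/=.
    rewrite -ltrBlDl (lt_le_trans un)// ler_piMl ?(ltW w0)//.
    by rewrite gerBl exprn_ge0// ltW.
  by rewrite mulr_ge0 ?(ltW w0)// subr_ge0 exprn_ile1// ltW.
rewrite UF ge0_integral_bigcup//=; last 3 first.
- by move=> n; exact: measurable_itv.
- rewrite -UF; apply: measurable_funTS.
  apply: (measurableT_comp (measurable_walk g d t k.+1)).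
  apply: measurable_funM; last exact: measurable_cst.
  by apply: measurable_funB => //; exact: measurable_cst.
- apply/trivIsetP => i j _ _ ij; apply/seteqP; split=> // u [/FE ui /FE uj].
  by move/eqP: ij; apply; exact: block_inj ui uj.
rewrite (gE d t) -nneseriesZl//=; last first.
  by move=> n _; rewrite mule_ge0// lee_fin mulr_ge0 ?exprn_ge0 ?subr_ge0 ?ltW.
apply: eq_eseriesr => n _; rewrite muleA -EFinM -(IH d.+1 _ (b n))//.
apply: eq_integral => u; rewrite inE => /FE un.
rewrite (dig_eq (r01 d) un); congr (g (walk _ _ (digits _ _) _)).
rewrite /dstep (dig_eq (r01 d) un) /b -[in LHS](mulfK (lt0r_neq0 w0) (1 - r d ^+ n)).
rewrite -mulrBl opprD addrA (mulrC (1 - _) w) -mulrA -invfM; congr (_ / _).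
Qed.

End digits.

(** * Decomposing a probability measure along a geometric series *)

Section split.
Context (disp : measure_display) (T : measurableType disp) {R : realType}.
Implicit Types (P K Q : probability T R) (r : R).

Lemma mnormalizeE (mu : {measure set T -> \bar R}) P c A : 0 < c ->
  mu setT = c%:E -> (mnormalize mu P A = mu A * c^-1%:E)%E.
Proof. by move=> c0 muT; rewrite /mnormalize muT eqe gt_eqF. Qed.

(** If [E] has mass at least [1 - r], the first component is [P] conditioned on [E] and the second
    the normalized rest; otherwise both are [P]. *)
Lemma prob_split P (E : set T) r : measurable E -> 0 < r < 1 ->
  exists KQ : probability T R * probability T R,
    (forall A, measurable A ->
      P A = (1 - r)%:E * KQ.1 A + r%:E * KQ.2 A)%E /\
    ((1 - r)%:E <= P E -> KQ.1 E = 1)%E.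
Proof.
move=> mE /andP[r0 r1].
have [PE|PE] := leP (1 - r)%:E (P E); last first.
  exists (P, P); split=> //= A mA.
  rewrite -ge0_muleDl ?lee_fin ?subr_ge0 ?ltW//.
  by rewrite -EFinD subrK mul1e.
pose p := fine (P E).
have PEp : P E = p%:E by rewrite fineK// fin_num_measure.
move: PE; rewrite PEp lee_fin => rp.
have p0 : 0 < p by rewrite (lt_le_trans _ rp)// subr_gt0.
have c0 : 0 <= 1 - (1 - r) / p by rewrite subr_ge0 ler_pdivrMr// mul1r.
have mEC := measurableC mE.
pose m1 := mrestr P mE.
(* The rest: [P] minus the fraction [(1 - r) / p] of its restriction to [E]. *)
pose m2 := measure_add (mrestr P mEC) (mscale (NngNum c0) m1).
have m1T : m1 setT = p%:E by rewrite /m1/= /mrestr setTI.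
have m1A A : measurable A -> m1 A = (fine (P (A `&` E)))%:E.
  by move=> mA; rewrite /m1/= /mrestr fineK// fin_num_measure//; exact: measurableI.
have m2E A : measurable A ->
    m2 A = (fine (P (A `\` E)) + (1 - (1 - r) / p) * fine (P (A `&` E)))%:E.
  move=> mA; rewrite /m2 measure_addE EFinD; congr (_ + _)%E.
    by rewrite /= /mrestr setDE fineK// fin_num_measure//; exact: measurableI.
  by rewrite -[LHS]/((1 - (1 - r) / p)%:E * m1 A)%E m1A.
have PD A : measurable A ->
    P A = (fine (P (A `\` E)) + fine (P (A `&` E)))%:E.
  move=> mA; have mAE := measurableI _ _ mA mE; have mADE := measurableD mA mE.
  rewrite EFinD !fineK ?fin_num_measure//.
  by rewrite (measureDI P mA mE).
have m2T : m2 setT = r%:E.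
  rewrite m2E// setTI -/p.
  have := PD _ measurableT; rewrite setTI -/p probability_setT => -[PT].
  have -> : (1 - (1 - r) / p) * p = p - (1 - r).
    by rewrite mulrBl divfK ?gt_eqF// mul1r.
  by congr EFin; lra.
exists (mnormalize m1 P : probability T R, mnormalize m2 P : probability T R).
split=> [A mA|_] /=.
  rewrite (mnormalizeE _ _ p0 m1T) (mnormalizeE _ _ r0 m2T).
  rewrite [X in (_ * (X * _) + _)%E]m1A// [X in (_ + _ * (X * _))%E]m2E// PD//.
  rewrite -!EFinM -EFinD; congr EFin; rewrite [r * _]mulrC divfK ?gt_eqF//.
  by rewrite mulrBl mul1r mulrCA mulrA mulrAC; lra.
rewrite (mnormalizeE _ _ p0 m1T) /= /mrestr setIid PEp -EFinM divff//.
by rewrite gt_eqF.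
Qed.

(** The rest is split repeatedly; [Q] is the rest after [n] steps, of weight [r ^ n], which tends to
    0. The set [E] may depend on [Q], since a heavy piece has to be chosen anew at each step. *)
Lemma prob_series P r (E : nat -> probability T R -> set T) :
  (forall n Q, measurable (E n Q)) -> 0 < r < 1 ->
  exists K : nat -> probability T R,
    (forall A, measurable A ->
      P A = \sum_(n <oo) ((1 - r) * r ^+ n)%R%:E * K n A)%E /\
    forall n, exists Q : probability T R,
      (forall A, measurable A -> ((r ^+ n)%R%:E * Q A <= P A)%E) /\
      ((1 - r)%:E <= Q (E n Q) -> K n (E n Q) = 1)%E.
Proof.
move=> mE r01; have /andP[r0 r1] := r01.
have /choice[kq kqP] : forall nQ : nat * probability T R, exists KQ, _ :=
  fun nQ => prob_split nQ.2 (mE nQ.1 nQ.2) r01.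
pose s := fix s n := if n is n.+1 then (kq (n, s n)).2 else P.
exists (fun n => (kq (n, s n)).1).
have PE n A : measurable A -> (P A = \sum_(0 <= i < n)
    ((1 - r) * r ^+ i)%R%:E * (kq (i, s i)).1 A + (r ^+ n)%R%:E * s n A)%E.
  move=> mA; elim: n => [|n IH]; first by rewrite big_nil add0e expr0 mul1e.
  rewrite big_nat_recr//= -addeA [LHS]IH; congr (_ + _)%E.
  have [/(_ A mA) /= sA _] := kqP (n, s n); rewrite sA.
  rewrite ge0_muleDr; last 2 first.
  - by rewrite mule_ge0// lee_fin subr_ge0 ltW.
  - by rewrite mule_ge0// lee_fin ltW.
  by rewrite !muleA -!EFinM exprSr [_ * (1 - r)]mulrC.
have w0 i : 0 <= (1 - r) * r ^+ i.
  by rewrite mulr_ge0 ?exprn_ge0 ?subr_ge0// ltW.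
split=> [A mA|n].
  apply/esym/cvg_lim => //.
  rewrite [X in X @ _ --> _](_ : _ =
      EFin \o (fun n => fine (P A) - r ^+ n * fine (s n A))); last first.
    apply/funext => n /=.
    rewrite EFinB EFinM !fineK ?fin_num_measure// (PE n A)// addeK//.
    by rewrite fin_numM// fin_num_measure.
  rewrite -[P A]fineK ?fin_num_measure//; apply: cvg_EFin; first exact: nearW.
  rewrite -[X in _ --> X]subr0; apply: cvgB; first exact: cvg_cst.
  apply: (squeeze_cvgr (f := fun=> 0) (h := fun n => r ^+ n)).
  - apply: nearW => n; rewrite mulr_ge0 ?exprn_ge0 ?fine_ge0//= ?(ltW r0)//.
    rewrite ler_piMr ?exprn_ge0 ?(ltW r0)// -lee_fin fineK ?fin_num_measure//.
    exact: probability_le1.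
  - exact: cvg_cst.
  - by apply: cvg_expr; rewrite gtr0_norm.
exists (s n); split=> [A mA|]; last by have [] := kqP (n, s n).
rewrite (PE n A)// leeDr// sume_ge0// => i _.
by rewrite mule_ge0// lee_fin.
Qed.

(** All weights are positive. Hence full measure passes from a node of the tree to its children. *)
Lemma series_null P r (K : nat -> probability T R) A n : 0 < r < 1 ->
  (P A = \sum_(n <oo) ((1 - r) * r ^+ n)%R%:E * K n A)%E ->
  (P A = 0 -> K n A = 0)%E.
Proof.
move=> /andP[r0 r1] PA PA0.
have w0 i : 0 < (1 - r) * r ^+ i by rewrite mulr_gt0 ?exprn_gt0// subr_gt0.
have t0 i : (0 <= ((1 - r) * r ^+ i)%R%:E * K i A)%E by rewrite mule_ge0// lee_fin ltW.
have : (\sum_(0 <= i < n.+1) ((1 - r) * r ^+ i)%R%:E * K i A <= P A)%E.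
  by rewrite PA; apply: nneseries_lim_ge.
rewrite PA0 big_nat_recr//= => le0.
have : (((1 - r) * r ^+ n)%R%:E * K n A <= 0)%E.
  by apply: le_trans le0; rewrite leeDr// sume_ge0.
rewrite pmule_rle0 ?lte_fin// => KA0.
by apply/eqP; rewrite eq_le KA0 measure_ge0.
Qed.

Lemma probability_setC0 P A : measurable A -> (P (~` A) = 0 <-> P A = 1)%E.
Proof.
move=> mA; rewrite probability_setC//.
have -> : P A = (fine (P A))%:E by rewrite fineK// fin_num_measure.
by split=> -[]; rewrite -?EFinB => ?; congr EFin; lra.
Qed.

Lemma probability_cover P (A : nat -> set T) m (q : R) :
  (forall i, measurable (A i)) -> (P (\bigcup_(i < m) A i) = 1)%E ->
  m%:R * q < 1 -> exists2 i, (i < m)%N & (q%:E <= P (A i))%E.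
Proof.
move=> mA PA mq; apply: contrapT => noi.
suff : (P (\bigcup_(i < m) A i) <= (m%:R * q)%:E)%E.
  by rewrite PA lee_fin leNgt mq.
have mU : measurable (\bigcup_(i < m) A i) by apply: bigcup_measurable.
apply: (@le_trans _ _ (\sum_(i < m) P (A i))%E).
  by apply: content_subadditive => //; rewrite bigcup_mkord.
apply: (@le_trans _ _ (\sum_(i < m) q%:E)%E).
  apply: lee_sum => i _; rewrite leNgt; apply/negP => qi.
  by apply: noi; exists i => //; exact: ltW.
by rewrite sumEFin sumr_const card_ord mulr_natl.
Qed.

Lemma bigcap_tail_probability P (G : nat -> set T) m :
  (forall j, measurable (G j)) ->
  (forall j, (1 - (2 ^ j.+2)%N%:R^-1)%:E <= P (G j))%E ->
  (P (~` (\bigcap_(j >= m) G j)) <= (2 ^+ m.+1)^-1%:E)%E.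
Proof.
move=> mG PG.
have -> : ~` (\bigcap_(j >= m) G j) = \bigcup_k ~` G (k + m)%N.
  rewrite setC_bigcap; apply/seteqP; split=> y [k].
    by move=> /= mk Gk; exists (k - m)%N; rewrite ?subnK.
  by move=> _ Gk; exists (k + m)%N => //=; exact: leq_addl.
apply: (@le_trans _ _ (\sum_(k <oo) P (~` G (k + m)%N))%E).
  apply: measure_sigma_subadditive => // [k|]; first exact: measurableC.
  by apply: bigcup_measurable => k _; exact: measurableC.
apply: (@le_trans _ _ (\sum_(k <oo) (1 / (2 ^ (k + m.+2))%:R)%:E)%E).
  apply: lee_nneseries => // k _; rewrite probability_setC//.
  rewrite leeBlDr ?fin_num_measure// -leeBlDl// -EFinB addnS mul1r.
  by rewrite addnS; exact: PG.
rewrite -[leRHS]/(_^-1%:E) -[X in X%:E]mul1r.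
by rewrite -(cvg_lim _ (@cvg_geometric_eseries_half R 1 m.+1)).
Qed.

End split.

(** Adding 2 to [N j] keeps the ratio positive even if [N j] is 0, and [N j] times [1 - ratio]
    strictly below 1, as the pigeonhole argument requires. *)
Definition ratio {R : realType} (N : nat -> nat) (d : nat) : R :=
  if d is j.+1 then 1 - (N j).+2%:R^-1 else 2^-1.

Lemma ratio01 {R : realType} N d : 0 < (ratio N d : R) < 1.
Proof.
case: d => [|j] /=; first by apply/andP; split; lra.
have N0 : 0 < (N j).+2%:R^-1 :> R by [].
have N1 : (N j).+2%:R^-1 < 1 :> R by rewrite invf_lt1// ltr1n.
by rewrite subr_gt0 N1 gtrBl.
Qed.

(** * Trees of probability measures concentrating on pieces *)

Section tree.
Context (disp : measure_display) (T : measurableType disp) {R : realType}.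
Variables (N : nat -> nat) (A : nat -> nat -> set T).
Hypothesis mA : forall j i, measurable (A j i).
Implicit Types P Q : probability T R.

Let G j := \bigcup_(i < N j) A j i.
Let K m := \bigcap_(j >= m) G j.
Let mG j : measurable (G j). Proof. exact: bigcup_measurable. Qed.
Let mK m : measurable (K m). Proof. exact: bigcap_measurableType. Qed.

(** At depth 0 the rest [Q] before component [m] satisfies 2^-m Q <= P, so the complement of [K m]
    has [Q]-mass at most 1/2 and the split applies. At depth [j.+1] every rest is still carried by
    [G j], and one of the [N j] pieces is heavy enough. *)
Let child_level d P : exists K' : nat -> probability T R, [/\
    (forall B, measurable B -> P B =
      \sum_(n <oo) ((1 - ratio N d) * ratio N d ^+ n)%R%:E * K' n B)%E,
    d = 0%N -> forall m, (P (~` K m) <= (2 ^+ m.+1)^-1%:E)%E -> K' m (K m) = 1%E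
  & forall j, d = j.+1 -> P (G j) = 1%E ->
      forall n, exists2 i, (i < N j)%N & K' n (A j i) = 1%E].
Proof.
case: d => [|j].
  have [K' [PK' K'E]] := @prob_series _ _ R P 2^-1 (fun m _ => K m)
    (fun m _ => mK m) (ratio01 N 0).
  exists K'; split=> // _ m PKm; have [Q [QP]] := K'E m; apply.
  suff : (Q (~` K m) <= (2^-1)%:E)%E.
    rewrite probability_setC// leeBlDr ?fin_num_measure// -leeBlDl//.
  have := le_trans (QP _ (measurableC (mK m))) PKm.
  rewrite exprVn exprSr invfM EFinM lee_pmul2l// ?lte_fin//.
pose r : R := ratio N j.+1.
(* The default [setT] is ruled out below by [probability_cover]. *)
pose E (n : nat) Q := if pselect (exists2 i, (i < N j)%N & ((1 - r)%:E <= Q (A j i))%E)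
  is left h then A j (projT1 (cid2 h)) else setT.
have mE n Q : measurable (E n Q) by rewrite /E; case: pselect.
have [K' [PK' K'E]] := prob_series P mE (ratio01 N j.+1).
exists K'; split=> // _ [<-] PG n; have [Q [QP QE]] := K'E n.
have QG : Q (G j) = 1%E.
  apply/probability_setC0 => //.
  have := QP _ (measurableC (mG j)).
  have /probability_setC0 -> // := PG; rewrite pmule_rle0 ?lte_fin => [QG0|].
    by apply/eqP; rewrite eq_le QG0 measure_ge0.
  by rewrite exprn_gt0//; have /andP[] := ratio01 (R := R) N j.+1.
have [//|i iN Qi] := probability_cover (mA j) QG (q := 1 - r).
  by rewrite /r /= opprB addrC subrK ltr_pdivrMr// mul1r ltr_nat.
move: QE; rewrite /E; case: pselect => [h QE|[]]; last by exists i.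
by case: (cid2 h) QE => i' /= i'N Qi' QE; exists i' => //; exact: QE.
Qed.

(** The node at depth 1 is carried by [K (x 0)], inside [G j], hence so is the node at depth [j.+1].
    Its children are each carried by one piece of scale [j], and so is everything from depth [j.+2]
    on. *)
Lemma tree_exists P :
  (forall j, (1 - (2 ^ j.+2)%N%:R^-1)%:E <= P (G j))%E ->
  exists child : nat -> probability T R -> nat -> probability T R,
    (forall d Q B, measurable B -> Q B = \sum_(n <oo)
      ((1 - ratio N d) * ratio N d ^+ n)%R%:E * child d Q n B)%E /\
    forall x j, (x 0%N <= j)%N ->
      (forall k, walk child 0 P x k.+1 (G j) = 1%E) /\
      exists2 i, (i < N j)%N & forall k, (j.+2 <= k)%N ->
        walk child 0 P x k (A j i) = 1%E.
Proof.
move=> PG.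
have /choice[c cP] := fun dQ : nat * probability T R => child_level dQ.1 dQ.2.
exists (fun d Q => c (d, Q)).
split=> [d Q B mB|x j xj]; first by have [+ _ _] := cP (d, Q); exact.
set W := walk _ 0 P x.
have WS k B : measurable B -> W k B = 1%E -> W k.+1 B = 1%E.
  move=> mB /probability_setC0 WB; apply/probability_setC0 => //.
  have [/(_ _ (measurableC mB)) sB _ _] := cP (k, W k).
  rewrite /W walkS add0n; apply: series_null sB _; first exact: ratio01.
  exact: WB.
have WD k i B : measurable B -> W k B = 1%E -> W (i + k)%N B = 1%E.
  by move=> mB WB; elim: i => // i IH; exact: WS.
have WK : W 1%N (K (x 0%N)) = 1%E.
  have [_ /(_ erefl) + _] := cP (0%N, P); apply.
  exact: bigcap_tail_probability.
have WG k : W k.+1 (G j) = 1%E.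
  rewrite -addn1; apply: WD => //; apply/eqP; rewrite eq_le probability_le1//=.
  by rewrite -WK le_measure ?inE//; exact: bigcap_inf.
split=> //; have [_ _ /(_ j erefl)] := cP (j.+1, W j.+1).
move=> /(_ (WG j) (x j.+1))[i iN Wi]; exists i => // k jk.
by rewrite -(subnK jk); apply: WD => //; rewrite /W walkS.
Qed.

End tree.

(** * The universal space *)

Section universal_space.
Context {R : realType}.
Variable N : nat -> nat.

(** The first case is 2 e_(k-2), for two points within e_(k-2) of a common point. In the second, 1
    absorbs 2 e_m and dominates the small scales, and the sum makes the bound monotone in [m]. *)
Definition uscale_fun (m k : nat) : R :=
  if (m.+2 <= k)%N then (2 ^ k.-1)%:R^-1 else (\sum_(i < m.+1) N i)%:R + 1.

Lemma uscale_gt0 m k : 0 < uscale_fun m k.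
Proof.
by rewrite /uscale_fun; case: ifP => _; rewrite ?invr_gt0 ?ltr0n ?expn_gt0// ltr_wpDl.
Qed.

Lemma uscale_homo m m' k k' : (m <= m')%N -> (k' <= k)%N ->
  uscale_fun m k <= uscale_fun m' k'.
Proof.
move=> mm kk; rewrite /uscale_fun.
have half j : (2 ^ j)%:R^-1 <= 1 :> R.
  by rewrite invf_le1 ?ler1n ?ltr0n ?expn_gt0.
case: ifP => mk; case: ifP => mk'.
- rewrite lef_pV2 ?posrE ?ltr0n ?expn_gt0// ler_nat leq_exp2l//.
  by rewrite -ltnS !prednK//; [exact: leq_trans mk|exact: leq_trans mk'].
- by rewrite (le_trans (half _))// lerDr.
- move/negbT: mk; rewrite -ltnNge ltnS => km.
  by have := leq_trans mk' (leq_trans kk km); rewrite ltnS ltnNge mm.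
- rewrite lerD2r ler_nat -!(big_mkord xpredT).
  by rewrite [leqRHS](@big_cat_nat _ _ _ m.+1)//= leq_addr.
Qed.

Lemma uscale_small m e : 0 < e -> exists k, uscale_fun m k < e.
Proof.
move=> e0; have [k _ ke] : \forall k \near \oo, (2^-1 : R) ^+ k < e.
  have /cvgrPdist_lt/(_ e e0) : (2^-1 ^+ n) @[n --> \oo] --> (0 : R).
    by apply: cvg_expr; rewrite gtr0_norm; lra.
  by apply: filterS => n /=; rewrite sub0r normrN gtr0_norm// exprn_gt0.
exists (maxn k m.+1).+1; rewrite /uscale_fun ltnS leq_maxr/=.
by have := ke (maxn k m.+1) (leq_maxl _ _); rewrite /= exprVn natrX.
Qed.

Definition uscale := Scale uscale_gt0 uscale_homo uscale_small.

Definition udigits : measurableTypeR R -> borel (baire uscale) := digits (ratio N) 0.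

Lemma measurable_udigits :
  measurable_fun setT (udigits : R -> borel (baire uscale)).
Proof.
apply: (@measurability _ _ _ (borel (baire uscale)) _ _
  (@open (baire uscale))) => // _ [U oU <-].
rewrite setTI (open_baireE oU) preimage_bigcup.
rewrite bigcup_mkcond; apply: countable_bigcupT_measurable => [|l].
  exact: countableP.
case: ifP => // _; exact: (measurable_digits_prefix (ratio01 N) l 0).
Qed.

(* The Borel sigma-algebras of R and of measurableTypeR R coincide, but have
   different displays, hence are not interchangeable in measurable_fun. *)
Let measurable_udigitsR :
  @measurable_fun _ _ (measurableTypeR R) (borel (baire uscale)) setT udigits.
Proof. by move=> _ B mB; exact: measurable_udigits. Qed.

HB.instance Definition _ :=
  isMeasurableFun.Build _ _ _ _ udigits measurable_udigitsR.

Definition unif01 := mrestr (@lebesgue_measure R) (measurable_itv `[0, 1[).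
HB.instance Definition _ := Measure.on unif01.

Lemma unif01_setT : unif01 setT = 1%E.
Proof.
by rewrite /unif01/= /mrestr setTI lebesgue_measure_itv/= lte_fin ltr01 oppr0 adde0.
Qed.

HB.instance Definition _ := Measure_isProbability.Build _ _ _ unif01 unif01_setT.

(** The law of the digits of a uniform number serves as the product of geometric distributions, so
    the digit map is a parameter of this space. *)
Definition uspace : mmspace R :=
  MMSpace (separable_baire uscale) (distribution unif01 udigits).

Lemma mm_parameter_udigits : @mm_parameter R uspace udigits.
Proof.
split=> [|A mA].
  exact: (@measurable_funTS _ _ _ (borel (baire uscale)) _ _ measurable_udigits).
by rewrite setIC.
Qed.
End universal_space.

(** * Borel measures on metric spaces *)

Section borel_metric.
Context {R : realType}.
Implicit Types X Y : completeMetricType R.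

Lemma borel_open X (U : set X) : open U -> measurable (U : set (borel X)).
Proof. by move=> oU; exact: sub_sigma_algebra. Qed.

Lemma borel_closed X (C : set X) : closed C -> measurable (C : set (borel X)).
Proof.
move=> cC; rewrite -[C]setCK; apply: (@measurableC _ (borel X)).
by apply: borel_open; exact: closed_openC.
Qed.

Lemma lipschitz1_measurable X Y (f : X -> Y) :
  (forall x x', mdist (f x) (f x') <= mdist x x') ->
  measurable_fun setT (f : borel X -> borel Y).
Proof.
move=> fL.
apply: (@measurability _ _ (borel X) (borel Y) _ _ (@open Y)) => // _ [U oU <-].
rewrite setTI; apply: borel_open; move: U oU; apply/continuousP => x.
apply/metricType_numDomainType.cvgrPdist_lt => e e0.
apply/nbhs_ballP; exists e => //= y.
by rewrite ballEmdist/=; exact: le_lt_trans (fL _ _).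
Qed.

(** A closed set is a decreasing intersection of open neighbourhoods, so the inequality extends to
    closed sets; complements turn it into equality on open sets, which generate. The one-sided
    hypothesis is what Fatou's lemma provides. *)
Lemma probability_le_open Y (P Q : probability (borel Y) R) :
  (forall U : set Y, open U -> (P U <= Q U)%E) ->
  forall A : set (borel Y), measurable A -> P A = Q A.
Proof.
move=> PQ.
have PQC (C : set Y) : closed C -> (P C <= Q C)%E.
  move=> cC; pose V n := \bigcup_(c in C) (ball c n.+1%:R^-1)°.
  have oV n : open (V n) by apply: bigcup_open => c _; exact: open_interior.
  have CV : C = \bigcap_n V n.
    apply/seteqP; split=> [c Cc n _|y Vy].
      by exists c => //; exact: nbhsx_ballx.
    apply: cC => B /nbhs_ballP[e /= e0 eB].
    have [n ne] : exists n, (n.+1%:R^-1 : R) < e.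
      have [n _ /(_ n (leqnn n)) ne] := near_infty_natSinv_lt (PosNum e0).
      by exists n.
    have [c Cc /interior_subset cy] := Vy n I; exists c; split=> //.
    by apply: eB; apply: (le_ball (ltW ne)); exact: ball_sym.
  have mC := borel_closed cC.
  have Vdecr : nonincreasing_seq (V : (set (borel Y))^nat).
    move=> m n mn; apply/subsetPset => y [c Cc cy]; exists c => //.
    by apply: interiorS cy; apply: le_ball; rewrite lef_pV2 ?posrE// ler_nat.
  have mV n := borel_open (oV n).
  have PV (P' : probability (borel Y) R) : P' \o V @ \oo --> P' C.
    rewrite CV; apply: nonincreasing_cvg_mu => //; last by rewrite -CV.
    by rewrite (le_lt_trans (probability_le1 _ _))// ltry.
  apply: (@le_trans _ _ (limn (P \o V))).
    by rewrite (cvg_lim _ (PV P)).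
  rewrite -(cvg_lim _ (PV Q))//; apply: lee_lim.
  - by apply/cvg_ex; eexists; exact: PV.
  - by apply/cvg_ex; eexists; exact: PV.
  - by apply: nearW => n; exact: PQ.
apply: (@measure_unique _ _ (borel Y) (@open Y) (fun=> setT)) => //.
- by move=> A B; exact: openI.
- by move=> n; exact: openT.
- by rewrite bigcup_const.
- move=> U oU; apply/eqP; rewrite eq_le; apply/andP; split; first exact: PQ.
  have mU := borel_open oU.
  have := PQC _ (open_closedC oU); rewrite !probability_setC//.
  have PE : P U = (fine (P U))%:E by rewrite fineK// fin_num_measure.
  have QE : Q U = (fine (Q U))%:E by rewrite fineK// fin_num_measure.
  rewrite PE QE -!EFinB !lee_fin lerD2l lerN2 => QP.
  by rewrite -[leLHS]fineK ?fin_num_measure// -[leRHS]fineK ?fin_num_measure.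
- by move=> n; rewrite (le_lt_trans (probability_le1 _ _))// ltry.
Qed.

End borel_metric.

(** * Domination by the universal space *)

Section dominated_uspace.
Context {R : realType}.

(** The real bound [D] is kept apart from [N] because a small box distance perturbs it by a small
    amount. *)
Definition tight (X : mmspace R) (e : R) (N : nat) (D : R) :=
  exists A : nat -> set (borel X), [/\ forall i, measurable (A i),
    forall i, (i < N)%N -> forall p q, A i p -> A i q -> mdist p q <= e,
    forall i j, (i < N)%N -> (j < N)%N ->
      forall p q, A i p -> A j q -> mdist p q <= D
    & ((1 - e)%:E <= mm_measure X (\bigcup_(i < N) A i))%E].

(** Points [c j] chosen in [C j] form a Cauchy sequence, since [C i] and [C j] meet. The sets need
    not be closed, so the limit is only close to them. *)
Lemma cauchy_sets_limit (Y : completeMetricType R) (C : nat -> set Y)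
    (e : nat -> R) m :
  e @ \oo --> (0 : R) ->
  (forall j, (m <= j)%N -> forall p q, C j p -> C j q -> mdist p q <= e j) ->
  (forall i j, (m <= i)%N -> (m <= j)%N -> C i `&` C j !=set0) ->
  exists y, forall j, (m <= j)%N -> forall p, C j p -> mdist y p <= e j.
Proof.
move=> e0 Ce CC.
have /choice[c cP] : forall j, exists p, (m <= j)%N -> C j p.
  move=> j; have [mj|_] := leqP m j; last by exists point.
  by have [p [Cp _]] := CC j j mj mj; exists p.
have cC i j p : (m <= i)%N -> (m <= j)%N -> C i p -> mdist p (c j) <= e i + e j.
  move=> mi mj Cp; have [z [Ciz Cjz]] := CC i j mi mj.
  apply: le_trans (metric_triangle p z (c j)) _.
  by apply: lerD; [exact: (Ce i)|apply: (Ce j) => //; exact: cP].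
have small r : 0 < r -> \forall j \near \oo, e j < r.
  move=> r0; have /cvgrPdist_lt/(_ _ r0) := e0.
  by apply: filterS => j /=; rewrite sub0r normrN; apply: le_lt_trans; rewrite ler_norm.
have : cvg (c @ \oo).
  apply: cauchy_cvg; apply/cauchyP => r r0.
  have [k _ kr] := small _ (divr_gt0 r0 (ltr0n R 2)).
  pose i := maxn k m; exists (c i); exists i => // j /= ij.
  have mi : (m <= i)%N by rewrite leq_maxr.
  have mj := leq_trans mi ij.
  rewrite ballEmdist/= (le_lt_trans (cC i j _ mi mj (cP i mi)))//.
  rewrite [ltRHS]splitr ltrD//; apply: kr => /=; first by rewrite leq_maxl.
  by rewrite (leq_trans _ ij)// leq_maxl.
move=> /cvg_ex[y /metricType_numDomainType.cvgrPdist_lt cy].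
exists y => j mj p Cp; apply/ler_addgt0Pr => r r0.
have r2 : 0 < r / 2 by rewrite divr_gt0.
have [k _ kr] := small _ r2; have [k' _ k'r] := cy _ r2.
pose i := maxn m (maxn k k').
have mi : (m <= i)%N by rewrite leq_maxl.
rewrite (le_trans (metric_triangle y (c i) p))// (metric_sym (c i)).
have := cC j i p mj mi Cp.
have := kr i; rewrite /= /i !leq_max leqnn orbT => /(_ isT).
by have := k'r i; rewrite /= /i !leq_max leqnn !orbT => /(_ isT); lra.
Qed.

Variables (N : nat -> nat) (Y : mmspace R).
Hypothesis tightY :
  forall j, tight Y (2 ^ j.+2)%:R^-1 (N j) (N j)%:R.

Lemma dominated_uspace : dominated Y (uspace N).
Proof.
have /choice[A AP] := tightY.
have mA j i : measurable (A j i) by have [] := AP j.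
have PG j : ((1 - (2 ^ j.+2)%N%:R^-1)%:E <= mm_measure Y (\bigcup_(i < N j) A j i))%E.
  by have [] := AP j.
have [child [childE childP]] := tree_exists mA PG.
pose W := walk child 0 (mm_measure Y).
pose e (j : nat) : R := (2 ^ j.+2)%:R^-1.
(* Sets of full measure for one node meet; pieces are compared through such common points. *)
have meet (P : probability (borel Y) R) B C : measurable B -> measurable C ->
    P B = 1%E -> P C = 1%E -> B `&` C !=set0.
  move=> mB mC PB PC; apply/set0P/eqP => BC0.
  have : (P B <= P (~` C))%E.
    apply: le_measure; rewrite ?inE//; first exact: measurableC.
    by apply/disjoints_subset.
  by rewrite PB ((probability_setC0 P mC).2 PC) lee_fin ler10.
have e_cvg : e @ \oo --> (0 : R).
  rewrite (_ : e = fun j => 2^-1 ^+ j.+2); last first.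
    by apply/funext => j; rewrite /e natrX exprVn.
  rewrite (cvg_shiftS (fun n => 2^-1 ^+ n.+1 : R)).
  rewrite (cvg_shiftS (fun n => 2^-1 ^+ n : R)).
  by apply: cvg_expr; rewrite gtr0_norm; lra.
have fE (x : baire (@uscale R N)) : exists y : Y, forall j,
    (x 0%N <= j)%N -> exists B : set (borel Y), [/\ measurable B,
      forall k, (j.+2 <= k)%N -> W x k B = 1%E
      & forall p, B p -> mdist y p <= e j].
  have /choice[i iP] : forall j, exists i, (x 0%N <= j)%N ->
      (i < N j)%N /\ forall k, (j.+2 <= k)%N -> W x k (A j i) = 1%E.
    move=> j; have [xj|_] := leqP (x 0%N) j; last by exists 0%N.
    by have [_ [i iN Wi]] := childP x j xj; exists i.
  have [||y yP] := cauchy_sets_limit (C := fun j => A j (i j)) (m := x 0%N) e_cvg.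
  - by move=> j /iP[iN _]; have [_ + _ _] := AP j; exact.
  - move=> j j' xj xj'; have [_ Wj] := iP j xj; have [_ Wj'] := iP j' xj'.
    apply: (@meet (W x (maxn j j').+2)) => //.
      by apply: Wj; rewrite !ltnS leq_maxl.
    by apply: Wj'; rewrite !ltnS leq_maxr.
  exists y => j xj; exists (A j (i j)); split=> //; last exact: yP.
  by have [] := iP j xj.
have /choice[f fP] := fE.
have fL x x' : mdist (f x) (f x') <= mdist x x'.
  have [[k0 xk0]|xx] := pselect (exists k, x k != x' k); last first.
    rewrite (_ : x = x') ?mdistxx//; apply/funext => k; apply/eqP/contraT => xk.
    by exfalso; apply: xx; exists k.
  have [k /eqP xk kmin] :=
    ex_minnP (ex_intro (fun k => x k != x' k) k0 xk0).
  apply: le_trans _ (bdist_ge xk); set m := maxn _ _.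
  rewrite /= /uscale_fun; case: ifPn => mk.
    (* As [k] is positive the first entries agree, and both walks are at the same node at depth
       [k = j.+2], which depends only on the entries before [k]. *)
    have xx0 : x 0%N = x' 0%N.
      apply/eqP/contraT => /kmin; rewrite leqn0 => /eqP k0E.
      by rewrite k0E in mk.
    have mx : m = x 0%N by rewrite /m -xx0 maxnn.
    case: k xk kmin mk => [//|[//|j]] xk kmin; rewrite 2!ltnS mx => xj.
    have [B [mB WB Bf]] := fP x j xj.
    have := fP x' j; rewrite -xx0 => /(_ xj)[B' [mB' WB' Bf']].
    have WW : W x j.+2 = W x' j.+2.
      by apply: eq_walk => i; rewrite ltnNge; apply: contraNeq => /kmin.
    have [|p [Bp B'p]] := meet (W x j.+2) _ _ mB mB' (WB _ (leqnn _)).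
      by rewrite WW WB'.
    rewrite (le_trans (metric_triangle _ p _))//.
    have := Bf p Bp; have := Bf' p B'p; rewrite [mdist _ p]metric_sym.
    have -> : (2 ^ j.+2.-1)%:R^-1 = e j + e j.
      by rewrite /e /= [in RHS]expnS natrM invfM; lra.
    by move=> *; rewrite addrC lerD// metric_sym.
  (* Each image is within e_m of some point of [G m], and two points of [G m] are at distance at
     most [N m]. *)
  have xm : (x 0%N <= m)%N by rewrite leq_maxl.
  have xm' : (x' 0%N <= m)%N by rewrite leq_maxr.
  have [B [mB WB Bf]] := fP x m xm; have [B' [mB' WB' Bf']] := fP x' m xm'.
  have mG : measurable (\bigcup_(i < N m) A m i) by apply: bigcup_measurable.
  have [p [Bp [i iN Ap]]] := meet (W x m.+2) _ _ mB mG (WB _ (leqnn _))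
    ((childP x m xm).1 _).
  have [p' [Bp' [i' i'N Ap']]] := meet (W x' m.+2) _ _ mB' mG (WB' _ (leqnn _))
    ((childP x' m xm').1 _).
  have [_ _ /(_ _ _ iN i'N _ _ Ap Ap') pp' _] := AP m.
  have fp := Bf _ Bp; have fp' := Bf' _ Bp'.
  rewrite (le_trans (metric_triangle _ p _))// addrC.
  rewrite (le_trans (lerD (metric_triangle p p' _) fp))//.
  rewrite [mdist p' _]metric_sym.
  have NS : (N m)%:R <= (\sum_(i < m.+1) N i)%:R :> R.
    by rewrite ler_nat big_ord_recr/= leq_addl.
  have e2 : e m <= 2^-1.
    rewrite /e lef_pV2 ?posrE ?ltr0n ?expn_gt0//.
    by rewrite -[leLHS]/((2 ^ 1)%N%:R) ler_nat leq_exp2l.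
  by clear -pp' fp fp' NS e2; lra.
exists f; split=> // B mB.
have mf : measurable_fun setT (f : borel (baire (@uscale R N)) -> borel Y).
  exact: lipschitz1_measurable.
pose F : {mfun borel (baire (@uscale R N)) >-> borel Y} :=
  HB.pack (f : borel (baire (@uscale R N)) -> borel Y)
    (isMeasurableFun.Build _ _ (borel (baire (@uscale R N))) (borel Y) f mf).
apply: (probability_le_open (P := distribution (mm_measure (uspace N)) F)) => //.
move=> U oU; have mU := borel_open oU.
pose D := (udigits N : R -> baire (@uscale R N)) @^-1` (f @^-1` U) `&` `[0, 1[.
have mD : measurable D.
  apply: measurableI; last exact: measurable_itv.
  rewrite -[X in measurable X]setTI.
  apply: (measurable_udigits (N := N)) => //.
  by rewrite -[X in measurable X]setTI; exact: (mf measurableT U mU).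
rewrite [leLHS](_ : _ = lebesgue_measure D)//.
(* For [v] in [D] the values [g k v] are eventually 1, while each [g k] has integral
   [mm_measure Y U] over [0, 1[; Fatou's lemma compares the two. *)
pose g k (v : R) := W (@udigits R N v) k U.
have mg k : measurable_fun setT (g k).
  exact: (@measurable_walk R _ (ratio01 N) _ child
    (fun P : probability (borel Y) R => P U) 0%N (mm_measure Y) k).
have gU k : (\int[lebesgue_measure]_(v in `[0%R, 1%R[) g k v = mm_measure Y U)%E.
  have := @integral_walk _ _ (ratio01 N) _ child
    (fun P : probability (borel Y) R => P U) (fun=> measure_ge0 _ _)
    (fun d Q => childE d Q U mU) k 0%N (mm_measure Y) 0 1 ltr01.
  rewrite add0r mul1e => <-; apply: eq_integral => v _.
  by rewrite subr0 divr1.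
have g1 v : D v -> limn_einf (g ^~ v) = 1%E.
  move=> [/= fU _]; set x := @udigits R N v in fU.
  have /nbhs_ballP[r /= r0 rU] : nbhs (f x) U by exact: open_nbhs_nbhs.
  have [j0 _ j0r] : \forall j \near \oo, e j < r.
    have /cvgrPdist_lt/(_ _ r0) := e_cvg.
    apply: filterS => j /=; rewrite sub0r normrN; apply: le_lt_trans.
    exact: ler_norm.
  pose j := maxn (x 0%N) j0.
  have [V [mV WV Vf]] := fP x j (leq_maxl _ _).
  have gv : g ^~ v @ \oo --> 1%E.
    apply: cvg_near_cst; exists j.+2 => // k /= jk.
    apply/eqP; rewrite eq_le probability_le1//= -(WV k jk).
    apply: le_measure; rewrite ?inE// => p /Vf fp.
    by apply: rU; rewrite ballEmdist/= (le_lt_trans fp)// j0r//= leq_maxr.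
  by have [] := cvg_limn_einf_sup gv.
have -> : lebesgue_measure D = (\int[lebesgue_measure]_(v in D) limn_einf (g ^~ v))%E.
  rewrite (eq_integral (cst 1%E)); last by move=> v /set_mem /g1.
  by rewrite integral_cst// mul1e.
have g0 k v : (0 <= g k v)%E by exact: measure_ge0.
have mgS (S : set R) k : @measurable_fun _ _ (measurableTypeR R) _ S (g k).
  by move=> mS V mV; exact: (@measurable_funTS _ _ _ _ S _ (mg k) mS V mV).
have /le_trans := @fatou _ _ _ lebesgue_measure D mD g (mgS D) (fun k v _ => g0 k v).
apply.
rewrite limn_einf_lim; apply: lime_le; first exact: is_cvg_einfs.
apply: nearW => k; rewrite -(gU k).
apply: (@le_trans _ _ (\int[lebesgue_measure]_(v in D) g k v)%E).
  by apply: ereal_inf_lbound; exists k => /=.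
by apply: ge0_subset_integral => // v [].
Qed.

End dominated_uspace.

(** * Tightness and the box distance *)

Section tight.
Context {R : realType}.
Implicit Types X Y : mmspace R.

Lemma tight_le X e e' N N' D D' : e <= e' -> (N <= N')%N -> D <= D' ->
  tight X e N D -> tight X e' N' D'.
Proof.
move=> ee NN DD [A [mA Ae AD AN]].
(* The added pieces are made empty, as [A i] is not controlled for [i >= N]. *)
exists (fun i => if (i < N)%N then A i else set0); split.
- by move=> i; case: ifP.
- by move=> i _ p q; case: ifP => // iN Ap Aq; exact: le_trans (Ae _ iN _ _ Ap Aq) ee.
- move=> i j _ _ p q; case: ifP => // iN; case: ifP => // jN Ap Aq.
  exact: le_trans (AD _ _ iN jN _ _ Ap Aq) DD.
- apply: (@le_trans _ _ (1 - e)%:E); first by rewrite lee_fin lerB.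
  apply: le_trans AN _; apply: le_measure; rewrite ?inE.
  + by apply: bigcup_measurable.
  + by apply: bigcup_measurable => i _; case: ifP.
  + move=> p [i /= iN Ap]; exists i => /=; first exact: leq_trans NN.
    by rewrite iN.
Qed.

Lemma separable_seq (T : completeMetricType R) : separable_space T ->
  exists c : nat -> T, forall x r, 0 < r -> exists n, mdist (c n) x < r.
Proof.
move=> [S /countable_injP[f finj] dS].
exists (fun n => xget point [set s | S s /\ f s = n]) => x r r0.
have [|s [/interior_subset xs Ss]] := dS (ball x r)° _ (open_interior _).
  by exists x; exact: nbhsx_ballx.
exists (f s); case: xgetP => [t _ [St ft]|/(_ s)]; last by case.
rewrite (finj t s) ?inE//; move: xs; rewrite ballEmdist/=.
by rewrite metric_sym.
Qed.

(** Balls of radius [e / 2] about a dense sequence cover [X], so finitely many have mass at least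
    [1 - e]; their mutual distances are bounded through the centres. *)
Lemma tight_exists X e : 0 < e -> exists n, tight X e n n%:R.
Proof.
move=> e0; have [c dc] := separable_seq (@mm_separable _ X).
pose A n : set X := (ball (c n) (e / 2))°.
have oA n : open (A n) by exact: open_interior.
have mA n : measurable (A n : set (borel X)) := borel_open (oA n).
have Ac n p : A n p -> mdist (c n) p <= e / 2.
  by move=> /interior_subset; rewrite ballEmdist/= => /ltW.
have A_cover : \bigcup_n A n = setT.
  apply/seteqP; split=> // y _; have e4 : 0 < e / 2 / 2 by rewrite !divr_gt0.
  have [n cy] := dc y _ e4; exists n => //; apply/nbhs_ballP.
  exists (e / 2 / 2) => //= z yz; rewrite [e / 2]splitr.
  by apply: ball_triangle yz; rewrite ballEmdist.
pose U N := \bigcup_(i < N) A i : set (borel X).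
have mU N : measurable (U N) by apply: bigcup_measurable.
have [N eN] : exists N, ((1 - e)%:E <= mm_measure X (U N))%E.
  apply: contrapT => noN.
  have Ucvg : mm_measure X \o U @ \oo --> mm_measure X (\bigcup_n U n).
    apply: nondecreasing_cvg_mu => //; first exact: bigcup_measurable.
    move=> m n mn; apply/subsetPset => p [i /= im Ap]; exists i => //=.
    exact: leq_trans mn.
  have UT : \bigcup_n U n = setT.
    apply/seteqP; split=> // p _; have [n _ Ap] : (\bigcup_n A n) p by rewrite A_cover.
    by exists n.+1 => //; exists n => /=.
  have : (limn (mm_measure X \o U) <= (1 - e)%:E)%E.
    apply: lime_le; first by apply/cvg_ex; eexists; exact: Ucvg.
    apply: nearW => n /=; rewrite leNgt; apply/negP => /ltW eU.
    by apply: noN; exists n.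
  by rewrite (cvg_lim _ Ucvg)// UT probability_setT lee_fin lerBrDr gerDl leNgt e0.
pose D := e + (\sum_(i < N) mdist (c 0%N) (c i)) *+ 2.
have AD i j p q : (i < N)%N -> (j < N)%N -> A i p -> A j q -> mdist p q <= D.
  have cD k : (k < N)%N -> mdist (c 0%N) (c k) <= \sum_(i < N) mdist (c 0%N) (c i).
    move=> kN; rewrite (bigD1 (Ordinal kN))//= lerDl sumr_ge0// => ? _.
    exact: mdist_ge0.
  move=> /cD iD /cD jD /Ac pi /Ac qj.
  have := metric_triangle p (c i) q.
  have := metric_triangle (c i) (c 0%N) q.
  have := metric_triangle (c 0%N) (c j) q.
  rewrite (metric_sym p (c i)) (metric_sym (c i) (c 0%N)) /D mulr2n; lra.
have D0 : 0 <= D.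
  by rewrite addr_ge0 ?(ltW e0)// mulrn_wge0// sumr_ge0// => ? _; exact: mdist_ge0.
have ND : tight X e N D.
  exists A; split=> //; last by move=> i j iN jN p q; exact: AD.
  move=> i _ p q /Ac ip /Ac iq.
  have := metric_triangle p (c i) q; rewrite (metric_sym p (c i)); lra.
exists (maxn N (Num.truncn D).+1); apply: tight_le ND => //.
  by rewrite leq_maxl.
have /andP[_ /ltW DD] := truncn_itv D0.
by rewrite (le_trans DD)// ler_nat leq_maxr.
Qed.

Lemma mm_parameter_exists X : exists phi : R -> X, mm_parameter phi.
Proof.
have /choice[N XN] : forall j, exists n, tight X (2 ^ j.+2)%:R^-1 n n%:R.
  by move=> j; apply: tight_exists; rewrite invr_gt0 ltr0n expn_gt0.
have [f [fL fX]] := dominated_uspace XN.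
have [mu_ muE] := @mm_parameter_udigits R N.
have mf := lipschitz1_measurable fL.
exists (fun v => f (udigits N v)); split.
  exact: (measurableT_comp (f := (f : borel (uspace N) -> borel X)) mf mu_).
move=> A mA; rewrite -fX// /pushforward -muE//.
by rewrite -[X in measurable X]setTI; exact: mf.
Qed.

(** Allows an image that may fail to be Borel to be replaced by its closure. *)
Lemma closure_mdist_le (T : completeMetricType R) (A B : set T) c :
  (forall p q, A p -> B q -> mdist p q <= c) ->
  forall p q, closure A p -> closure B q -> mdist p q <= c.
Proof.
move=> ABc p q Ap Bq; apply/ler_addgt0Pr => r r0.
have r2 : 0 < r / 2 by rewrite divr_gt0.
have [p' [Ap']] := Ap _ (nbhsx_ballx p _ r2).
have [q' [Bq']] := Bq _ (nbhsx_ballx q _ r2).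
rewrite !ballEmdist/= => qq' pp'.
have := metric_triangle p p' q; have := metric_triangle p' q' q.
have := ABc _ _ Ap' Bq'; rewrite (metric_sym q' q); lra.
Qed.

(** Pieces are transported by the pair of parameters, over the good set [I]. That [e'] is strictly
    below [e] is what makes tightness an open condition. *)
Lemma tight_box_lt X Y a N D e : tight X a N D -> box X Y < e ->
  exists2 e', e' < e & tight Y (a + e') N (D + e').
Proof.
move=> [A [mA Aa AD AN]] /inf_lt[].
  (* The infimum is over a nonempty set: it contains 1, with any parameters and empty [I0]. *)
  have [phi mphi] := mm_parameter_exists X.
  have [psi mpsi] := mm_parameter_exists Y.
  exists 1; split=> //; exists phi, psi, set0; split=> //; last first.
    by rewrite subrr measure_ge0.
  by split.
move=> e' [e'0 [phi [psi [I [[mphi phiE] [mpsi psiE] [mI I01] eI dI]]]]] e'e.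
exists e' => //; pose B i : set Y := closure (psi @` (I `&` phi @^-1` A i)).
have mB i : measurable (B i : set (borel Y)).
  by apply: borel_closed; exact: closed_closure.
have BB i j c : (forall p q, A i p -> A j q -> mdist p q <= c) ->
    forall p q, B i p -> B j q -> mdist p q <= c + e'.
  move=> Ac; apply: closure_mdist_le => _ _ [s [Is As] <-] [t [It At] <-].
  have := dI s t Is It; have := Ac _ _ As At.
  rewrite ler_distlC => ? /andP[_]; lra.
exists B; split=> //.
- by move=> i iN; apply: BB; exact: Aa.
- by move=> i j iN jN; apply: BB; exact: AD.
have mAU : measurable (\bigcup_(i < N) A i) by apply: bigcup_measurable.
have mBU : measurable (\bigcup_(i < N) B i : set (borel Y)).
  by apply: bigcup_measurable => i _; exact: mB.
have m01 : measurable (`[0, 1[%classic : set R) by exact: measurable_itv.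
pose J : set R := `[0, 1[%classic `&` phi @^-1` (\bigcup_(i < N) A i).
have mJ : measurable J by exact: (mphi m01 _ mAU).
have mK : measurable (`[0, 1[%classic `&` psi @^-1` (\bigcup_(i < N) B i)).
  exact: (mpsi m01 _ mBU).
rewrite -psiE//; apply: (@le_trans _ _ (lebesgue_measure (I `&` J))); last first.
  apply: le_measure; rewrite ?inE//; first exact: measurableI.
  move=> s [Is [s01 [i iN As]]]; split=> //; exists i => //.
  by apply: subset_closure; exists s.
have L01 : lebesgue_measure (`[0, 1[%classic : set R) = 1%E.
  by rewrite lebesgue_measure_itv/= lte_fin ltr01 oppr0 adde0.
have fin (S : set R) : measurable S -> S `<=` `[0, 1[ ->
    lebesgue_measure S = (fine (lebesgue_measure S))%:E :> \bar R.
  move=> mS S01; rewrite fineK// ge0_fin_numE//.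
  apply: le_lt_trans (ltry 1); rewrite -L01; apply: le_measure; rewrite ?inE//.
have mIJ := measurableI _ _ mI mJ.
(* In [0, 1[, [I] misses measure at most [e'] and [J] at most [a], so their intersection has measure
   at least [1 - (a + e')]. *)
have : (lebesgue_measure I <=
    lebesgue_measure (I `&` J) + lebesgue_measure (`[0%R, 1%R[ `\` J))%E.
  rewrite (measureDI lebesgue_measure mI mJ) addeC; apply: leeD2l.
  apply: le_measure; rewrite ?inE; [exact: measurableD|exact: measurableD|].
  by move=> s [/I01].
move=> /(le_trans eI).
have mD : measurable ((`[0, 1[ : set R) `\` J) by exact: measurableD.
have DE := fin _ mD (fun s Ds => Ds.1).
have IE := fin _ mIJ (fun s Is => I01 _ Is.1).
have JE := fin _ mJ (fun s Js => Js.1).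
have IJE : (`[0, 1[%classic : set R) `&` J = J.
  by apply/seteqP; split=> s => [[]|Js]//; split=> //; case: Js.
have : (lebesgue_measure (`[0%R, 1%R[%classic : set R) =
    lebesgue_measure (`[0%R, 1%R[ `\` J) + lebesgue_measure J)%E.
  by have := measureDI lebesgue_measure m01 mJ; rewrite IJE.
move: AN; rewrite -phiE// -/J L01 DE IE JE -!EFinD !lee_fin => aj [] ? ?.
by clear DE IE JE fin L01; lra.
Qed.

End tight.

(** * Isomorphism invariance of tightness and uniform bounds on compact sets *)

Section precompact.
Context {R : realType}.
Implicit Types X Y : mmspace R.

(** By separability, countably many null balls, with centres in a dense sequence and radii 1 / (n +
    1), cover the complement of the support. *)
Lemma mm_supp_setC X :
  mm_measure X (~` @mm_supp R X : set (borel X)) = 0%E.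
Proof.
have [c dc] := separable_seq (@mm_separable _ X).
pose B k n : set X := (ball (c k) n.+1%:R^-1)°.
have oB k n : open (B k n) by exact: open_interior.
have mB k n : measurable (B k n : set (borel X)) := borel_open (oB k n).
have mS : measurable (@mm_supp R X : set (borel X)) by exact: mm_supp_measurable.
apply/negligibleP; first exact: measurableC.
pose G k n : set (borel X) := if mm_measure X (B k n) == 0%E then B k n else set0.
apply: (negligibleS (A := \bigcup_k \bigcup_n G k n)); last first.
  apply: negligible_bigcup => k; apply: negligible_bigcup => n.
  rewrite /G; case: ifP => [/eqP B0|_]; last exact: negligible_set0.
  exact/negligibleP.
move=> x /existsNP[U] /not_implyP[oU] /not_implyP[Ux /negP].
rewrite -leNgt => U0.
have /nbhs_ballP[e /= e0 eU] : nbhs x U by exact: open_nbhs_nbhs.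
have [n _ /(_ n (leqnn n)) /= ne] :=
  near_infty_natSinv_lt (PosNum (divr_gt0 e0 (ltr0n R 2))).
have n2 : 0 < n.+1%:R^-1 / 2 :> R by rewrite divr_gt0.
have [k kx] := dc x _ n2.
exists k => //; exists n => //; rewrite /G ifT.
  apply/nbhs_ballP; exists (n.+1%:R^-1 / 2) => //= z xz.
  by rewrite [_^-1]splitr; apply: ball_triangle xz; rewrite ballEmdist.
apply/eqP/le_anti; rewrite measure_ge0 andbT (le_trans _ U0)//.
apply: le_measure; rewrite ?inE//; first exact: borel_open.
move=> y /interior_subset ky; apply: eU; rewrite [e]splitr.
apply: ball_triangle (le_ball (ltW ne) ky); apply: ball_sym.
rewrite ballEmdist/= (lt_trans kx)// (le_lt_trans _ ne)//.
by rewrite ler_pdivrMr// ler_peMr// ler1n.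
Qed.

(** The isometry carries the pieces over; restricting them to the support loses only a null set. *)
Lemma tight_isomorphic X Y e N D :
  mm_isomorphic X Y -> tight X e N D -> tight Y e N D.
Proof.
move=> [F [_ Fd Fm]] [A [mA Ae AD AN]].
pose B i : set Y := closure (F @` (@mm_supp R X `&` A i)).
have mB i : measurable (B i : set (borel Y)).
  by apply: borel_closed; exact: closed_closure.
have BB i j c : (forall p q, A i p -> A j q -> mdist p q <= c) ->
    forall p q, B i p -> B j q -> mdist p q <= c.
  move=> Ac; apply: closure_mdist_le => _ _ [p [sp Ap] <-] [q [sq Aq] <-].
  by rewrite Fd ?inE//; exact: Ac.
exists B; split=> //.
- by move=> i iN; apply: BB; exact: Ae.
- by move=> i j iN jN; apply: BB; exact: AD.
have mAU : measurable (\bigcup_(i < N) A i) by apply: bigcup_measurable.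
have mBU : measurable (\bigcup_(i < N) B i : set (borel Y)).
  by apply: bigcup_measurable => i _; exact: mB.
have mX := mm_supp_measurable (X := X); have mY := mm_supp_measurable (X := Y).
apply: (le_trans AN).
apply: (@le_trans _ _
  (mm_measure Y (@mm_supp R Y `&` \bigcup_(i < N) B i))); last first.
  by apply: le_measure; rewrite ?inE//; exact: measurableI.
rewrite -Fm//.
have mXB : measurable (@mm_supp R X `&` F @^-1` (\bigcup_(i < N) B i) : set (borel X)).
  exact: (isometry_measurable Fd mX mBU).
rewrite [leLHS](measureDI _ mAU mX) [X in (X + _)%E](_ : _ = 0%E) ?add0e.
  apply: le_measure; rewrite ?inE//; first exact: measurableI.
  move=> x [[i iN Ax] sx]; split=> //; exists i => //.
  by apply: subset_closure; exists x.
apply/eqP; rewrite eq_le; apply/andP; split; last exact: measure_ge0.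
rewrite -(mm_supp_setC X).
apply: le_measure; rewrite ?inE; [exact: measurableD|exact: measurableC|].
by move=> x [].
Qed.

(** The strict inequalities leave room for a box ball, which makes this set open. *)
Definition tight_class (e : R) (n : nat) : set (mmclass R) :=
  [set C | exists a D, [/\ a < e, D < n%:R & tight (repr C) a n D]].

Lemma open_tight_class e n : open (tight_class e n).
Proof.
move=> C [a [D [ae Dn CaD]]].
exists (Order.min (e - a) (n%:R - D)); first by rewrite lt_min !subr_gt0 ae.
move=> C' /(tight_box_lt CaD)[e']; rewrite lt_min => /andP[e'a e'D] C'e'.
by exists (a + e'), (D + e'); split=> //; rewrite -ltrBrDl.
Qed.

Lemma tight_class_homo e m n : (m <= n)%N -> tight_class e m `<=` tight_class e n.
Proof.
move=> mn C [a [D [ae Dm CaD]]]; exists a, D; split=> //.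
  by rewrite (lt_le_trans Dm)// ler_nat.
exact: tight_le CaD.
Qed.

Lemma compact_tight (K : set (mmclass R)) e : compact K -> 0 < e ->
  exists n, forall C, K C -> tight (repr C) e n n%:R.
Proof.
move=> cK e0.
(* An arbitrary base point, for the open-cover form of compactness. *)
pose T : ptopologicalType := HB.pack (mmclass R)
  (isPointed.Build (mmclass R) (\pi_(mmclass R) (uspace id))).
have {}cK : @cover_compact T K by rewrite -compact_cover.
have [|C _|G _ KG] := cK nat setT (tight_class e).
- by move=> n _; exact: open_tight_class.
- have [n Cn] := tight_exists (repr C) (divr_gt0 e0 (ltr0n R 2)).
  exists n.+1 => //; exists (e / 2), n%:R; split.
  + by rewrite ltr_pdivrMr// ltr_pMr// ltr1n.
  + by rewrite ltr_nat.
  + exact: tight_le Cn.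
exists (\max_(i <- finmap.enum_fset G) i) => C /KG [n nG Cn].
have nmax : (n <= \max_(i <- finmap.enum_fset G) i)%N.
  by apply: (@leq_bigmax_seq _ _ xpredT id).
have [a [D [ae Dn CaD]]] := tight_class_homo nmax Cn.
by apply: tight_le CaD => //; exact: ltW.
Qed.

End precompact.

Theorem theorem1 (R : realType) (Ys : set (mmclass R)) :
  compact (closure Ys) ->
  exists X : mmspace R, forall Y : mmspace R,
    Ys (\pi_(mmclass R) Y) -> dominated Y X.
Proof.
move=> cY; have /choice[N NP] : forall j, exists n, forall C, closure Ys C ->
    tight (repr C) (2 ^ j.+2)%:R^-1 n n%:R.
  by move=> j; apply: compact_tight cY _; rewrite invr_gt0 ltr0n expn_gt0.
exists (uspace N) => Y YsY; apply: dominated_uspace => j.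
(* The bounds are known for the representative chosen by the quotient, which is only isomorphic to
   [Y]. *)
have YY : mm_isomorphic (repr (\pi_(mmclass R) Y)) Y.
  by have /eqmodP/asboolP := reprK (\pi_(mmclass R) Y).
by apply: tight_isomorphic YY _; apply: NP; exact: subset_closure.
Qed.
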